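(* There is an absolute constant $C$ such that the following holds. Let $G$ be an $m_\ell \times m_s$ grid graph with $m_\ell \ge m_s$, $m_\ell \ge 3$, $m_s \ge 2$, and let $X_I, X_G$ be arbitrary configurations of $m_\ell m_s$ labeled robots on $G$ (all vertices occupied). Then the instance $(G, X_I, X_G)$ admits a solution with makespan at most $C\, m_\ell$.
   Context: The $m_\ell \times m_s$ grid graph has vertex set $\{1,\dots,m_\ell\}\times\{1,\dots,m_s\}$ with edges between vertices at $\ell_1$-distance 1 (unit edge lengths). Multi-robot path planning (MPP) on a graph $G=(V,E)$: at each integer time step each robot occupies a vertex and a configuration is an injective map from robot labels to $V$ (here all vertices are occupied, so it is a bijection). From step $t$ to $t+1$ each robot either stays put or moves to an adjacent vertex, subject to: (i) the configuration at $t+1$ is again injective, and (ii) no two robots traverse the same edge in opposite directions. A solution of $(G,X_I,X_G)$ is a sequence of such moves from $X_I$ to $X_G$; its makespan is the number of time steps. *)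

(* Defs.v *)
From mathcomp Require Import all_boot.
Set Implicit Arguments. Unset Strict Implicit. Unset Printing Implicit Defensive.

Definition grid_vertex (ml ms : nat) : finType := ('I_ml * 'I_ms)%type.

Definition grid_adj (ml ms : nat) (u v : grid_vertex ml ms) : bool :=
  ((val u.1 == val v.1) && (((val u.2).+1 == val v.2) || ((val v.2).+1 == val u.2)))
  || ((val u.2 == val v.2) && (((val u.1).+1 == val v.1) || ((val v.1).+1 == val u.1))).

Definition robot (ml ms : nat) : finType := 'I_(ml * ms).
Definition config (ml ms : nat) := robot ml ms -> grid_vertex ml ms.

(* A configuration must be injective (here it is then a bijection). *)
Definition valid_config (ml ms : nat) (X : config ml ms) : Prop := injective X.

Definition valid_step (ml ms : nat) (X Y : config ml ms) : Prop :=
  [/\ forall r, Y r = X r \/ grid_adj (X r) (Y r),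
      injective Y &
      forall r1 r2, r1 <> r2 -> ~ (Y r1 = X r2 /\ Y r2 = X r1)].

Definition is_solution (ml ms : nat) (XI XG : config ml ms) (T : nat)
    (P : nat -> config ml ms) : Prop :=
  [/\ P 0 = XI, P T = XG,
      forall t, t <= T -> injective (P t) &
      forall t, t < T -> valid_step (P t) (P t.+1)].

(* Main.v *)
Require Import Defs.
From mathcomp Require Import all_boot zify.
Set Implicit Arguments. Unset Strict Implicit. Unset Printing Implicit Defensive.

(** Since every vertex is occupied, a time step is a permutation of the vertices
    (a "move"), and the theorem says that every permutation of the grid is a
    product of [O(ml)] moves.

    In a 2x3 block, turning the left square, then the right square, then the outer
    6-cycle backwards exchanges two horizontal neighbours and nothing else; hence
    any two neighbours of the grid can be exchanged by at most 5 moves inside a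
    block around them. Blocks around edges that are far apart do not interact, so
    any matching of horizontal edges splits into 25 classes that are each exchanged
    in parallel, at a total cost of 125 moves. Odd-even transposition sort then
    realises all permutations preserving the rows in [2 n] such matchings, and by
    transposition the same holds for columns. Finally, by Koenig's edge colouring
    theorem (via Hall), every permutation of the grid is a column permutation,
    followed by a row permutation, followed by a column permutation. *)

(** * Permutations that are products of a given number of moves *)

Section Reach.
Variables (V : finType) (e : rel V).

(** The last clause excludes 2-cycles: when every vertex is occupied, this is the ban on traversing
    an edge in both directions at once. *)
Definition is_move (f : V -> V) : Prop :=
  [/\ injective f, forall v, f v = v \/ e v (f v) &
      forall v, f (f v) = v -> f v = v].

Fixpoint reach (k : nat) (h : V -> V) : Prop :=
  if k is k'.+1 then
    exists g f, [/\ is_move g, reach k' f & h =1 f \o g]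
  else h =1 id.

Lemma id_is_move : is_move id.
Proof. by split=> // v; left. Qed.

Lemma reach_eq k h h' : h =1 h' -> reach k h -> reach k h'.
Proof.
case: k => [|k] eqh /=; first by move=> hid v; rewrite -eqh hid.
by case=> g [f [mg rf hE]]; exists g, f; split=> // v; rewrite -eqh hE.
Qed.

Lemma reach_comp k l f g : reach k f -> reach l g -> reach (k + l) (f \o g).
Proof.
move=> rf; elim: l g => [|l IHl] g /=.
  by rewrite addn0 => gid; apply: reach_eq rf => v /=; rewrite gid.
case=> m [g' [mm rg' gE]]; rewrite addnS; exists m, (f \o g').
by split=> //; [exact: IHl | move=> v /=; rewrite gE].
Qed.

Lemma reach_id k : reach k id.
Proof. by elim: k => //= k IHk; exists id, id; split=> //; exact: id_is_move. Qed.

Lemma reach_leq k l f : k <= l -> reach k f -> reach l f.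
Proof.
by move=> lekl rf; rewrite -(subnKC lekl); exact: reach_comp rf (reach_id _).
Qed.

Lemma reach_move g : is_move g -> reach 1 g.
Proof. by move=> mg; exists g, id. Qed.

End Reach.

(** The extra step comes last and moves no robot. It replaces a function pointwise equal to [Y] by
    [Y] itself, since [is_solution] asks for equality of functions. *)
Lemma reach_solution (ml ms k : nat) (f : grid_vertex ml ms -> grid_vertex ml ms)
    (X Y : config ml ms) :
  reach (@grid_adj ml ms) k f -> injective X -> Y =1 f \o X ->
  exists P, is_solution X Y k.+1 P.
Proof.
elim: k f X => [|k IHk] f X /=.
  move=> fid injX YE; have YX : Y =1 X by move=> r; rewrite YE /= fid.
  have injY : injective Y by move=> u v; rewrite !YX => /injX.
  exists (fun t => if t is 0 then X else Y); split=> //; first by case.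
  case=> // _; split=> //; first by move=> r; left.
  by move=> r1 r2 ne [E _]; apply: ne; apply: injX; rewrite -E YX.
case=> g [f' [[injg adjg nswg] rf' fE]] injX YE.
have injgX : injective (g \o X) by move=> u v /= /injg /injX.
have YE' : Y =1 f' \o (g \o X) by move=> r; rewrite YE /= fE.
have [P [P0 PT Pinj Pstep]] := IHk f' _ rf' injgX YE'.
exists (fun t => if t is t'.+1 then P t' else X); split=> //.
  by case=> // t; exact: Pinj.
case=> [_|t]; last exact: Pstep.
rewrite P0; split=> //; first by move=> r; exact: adjg.
move=> r1 r2 ne [/= E1 E2]; apply: ne; apply: injX.
by rewrite -E1 nswg // E1 E2.
Qed.

(** * Simultaneous moves in disjoint copies of a graph *)

Section Extension.
Variables (T B V : finType) (eB : rel B) (eV : rel V) (F : T -> B -> V).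
Hypothesis Finj : forall t t' b b', F t b = F t' b' -> t = t' /\ b = b'.
Hypothesis Fadj : forall t b b', eB b b' -> eV (F t b) (F t b').

Definition extend (g : T -> B -> B) (v : V) : V :=
  if [pick p : T * B | F p.1 p.2 == v] is Some p then F p.1 (g p.1 p.2) else v.

Lemma extendE g t b : extend g (F t b) = F t (g t b).
Proof.
rewrite /extend; case: pickP => [[t' b'] /= /eqP /Finj [-> ->] //|].
by move/(_ (t, b)); rewrite /= eqxx.
Qed.

Lemma extend_out g v : (forall t b, F t b <> v) -> extend g v = v.
Proof.
by move=> out; rewrite /extend; case: pickP => // -[t b] /= /eqP /out.
Qed.

Lemma image_dec v : (exists t b, F t b = v) \/ (forall t b, F t b <> v).
Proof.
case: (pickP (fun p : T * B => F p.1 p.2 == v)) => [[t b] /= /eqP E|no].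
  by left; exists t, b.
by right=> t b E; have := no (t, b); rewrite /= E eqxx.
Qed.

Lemma extend_move g : (forall t, is_move eB (g t)) -> is_move eV (extend g).
Proof.
move=> mg; split.
- move=> u v; case: (image_dec u) (image_dec v) => [[t [b <-]]|uo] [[t' [b' <-]]|vo].
  + rewrite !extendE => /Finj [<-]; have [injg _ _] := mg t.
    by move=> E; congr F; apply: injg; rewrite E.
  + by rewrite extendE extend_out // => /vo.
  + by rewrite extend_out // extendE => /esym /uo.
  + by rewrite !extend_out.
- move=> v; case: (image_dec v) => [[t [b <-]]|vo]; last by left; rewrite extend_out.
  rewrite extendE; have [_ adjg _] := mg t.
  by case: (adjg b) => [->|/Fadj]; [left | right].
- move=> v; case: (image_dec v) => [[t [b <-]]|vo]; last by move=> _; rewrite extend_out.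
  rewrite !extendE => /Finj [_ E]; have [_ _ nsw] := mg t.
  by rewrite nsw.
Qed.

(** The copies are disjoint, so their moves are made simultaneously and the cost does not grow with
    the number of copies. *)
Lemma reach_extend k (g : T -> B -> B) (H : V -> V) :
  (forall t, reach eB k (g t)) ->
  (forall t b, H (F t b) = F t (g t b)) ->
  (forall v, (forall t b, F t b <> v) -> H v = v) ->
  reach eV k H.
Proof.
elim: k g H => [|k IHk] g H /=.
  move=> gid HF Hout v; case: (image_dec v) => [[t [b <-]]|/Hout //].
  by rewrite HF gid.
move=> /fin_all_exists [m /fin_all_exists [f mf]] HF Hout.
exists (extend m), (extend f); split.
- by apply: extend_move => t; case: (mf t).
- apply: (IHk f); [by move=> t; case: (mf t) | exact: extendE | exact: extend_out].
- move=> v /=; case: (image_dec v) => [[t [b <-]]|vo].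
    by rewrite HF !extendE; case: (mf t) => _ _ ->.
  by rewrite Hout // [extend m v]extend_out // extend_out.
Qed.

End Extension.

(** * Swapping two neighbours inside a 2x3 block *)

Definition block : finType := (bool * option bool)%type.

(* The labels [a b c] of the top row and [d e f] of the bottom row of the block;
   in the second component, [None] is the middle column. *)
Local Notation ba := (false, Some false).
Local Notation bb := (false, None).
Local Notation bc := (false, Some true).
Local Notation bd := (true, Some false).
Local Notation be := (true, None).
Local Notation bf := (true, Some true).

Definition block_adj (x y : block) : bool :=
  ((x.1 == y.1) && ((x.2 == None) != (y.2 == None))) || ((x.1 != y.1) && (x.2 == y.2)).

Definition left_cw (x : block) : block :=
  match x with ba => bb | bb => be | be => bd | bd => ba | _ => x end.
Definition left_ccw (x : block) : block :=
  match x with bb => ba | be => bb | bd => be | ba => bd | _ => x end.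
Definition right_cw (x : block) : block :=
  match x with bb => bc | bc => bf | bf => be | be => bb | _ => x end.
Definition outer_ccw (x : block) : block :=
  match x with ba => bd | bd => be | be => bf | bf => bc | bc => bb | _ => ba end.

Ltac block_move :=
  split; [by move=> [[] [[]|]] [[] [[]|]]
         |by move=> [[] [[]|]]; (left; reflexivity) || (right; reflexivity)
         |by move=> [[] [[]|]]].

Lemma left_cw_move : is_move block_adj left_cw.
Proof. block_move. Qed.

Lemma left_ccw_move : is_move block_adj left_ccw.
Proof. block_move. Qed.

Lemma right_cw_move : is_move block_adj right_cw.
Proof. block_move. Qed.

Lemma outer_ccw_move : is_move block_adj outer_ccw.
Proof. block_move. Qed.

Definition swap (T : eqType) (x y z : T) : T :=
  if z == x then y else if z == y then x else z.

Lemma reach_swap_ab : reach block_adj 3 (swap ba bb).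
Proof.
have := reach_comp (reach_move outer_ccw_move)
  (reach_comp (reach_move right_cw_move) (reach_move left_cw_move)).
by apply: reach_eq => -[[] [[]|]].
Qed.

(** Conjugation: [left_cw] carries the edge [ba]-[bb] to [bb]-[be], so a turn before and a turn
    after the three known moves suffice. The swap of [ba] and [bd] uses the opposite turns. *)
Lemma reach_swap_be : reach block_adj 5 (swap bb be).
Proof.
have := reach_comp (reach_move left_cw_move)
  (reach_comp reach_swap_ab (reach_move left_ccw_move)).
by apply: reach_eq => -[[] [[]|]].
Qed.

Lemma reach_swap_ad : reach block_adj 5 (swap ba bd).
Proof.
have := reach_comp (reach_move left_ccw_move)
  (reach_comp reach_swap_ab (reach_move left_cw_move)).
by apply: reach_eq => -[[] [[]|]].
Qed.

(** * Hall's theorem and edge colourings *)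

Section Hall.
Variable T : finType.
Implicit Types (D S : {set T}) (r : T -> {set T}).

Definition nbrs r S : {set T} := \bigcup_(i in S) r i.

Lemma nbrsU r S1 S2 : nbrs r (S1 :|: S2) = nbrs r S1 :|: nbrs r S2.
Proof. exact: bigcup_setU. Qed.

Lemma nbrsD r (A : {set T}) S : nbrs (fun i => r i :\: A) S = nbrs r S :\: A.
Proof.
apply/setP=> y; rewrite in_setD; apply/bigcupP/andP.
  by case=> i iS; rewrite in_setD => /andP[yA yr]; split=> //; apply/bigcupP; exists i.
by case=> yA /bigcupP[i iS yr]; exists i => //; rewrite in_setD yA.
Qed.

(** Induction on the size of [D]. If some nonempty proper subset is tight, it and its complement are
    matched separately. Otherwise every such subset has a spare neighbour, and an arbitrary pair may
    be matched and removed. *)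
Lemma hall_marriage r D :
  (forall S, S \subset D -> #|S| <= #|nbrs r S|) ->
  exists f : T -> T, {in D, forall i, f i \in r i} /\ {in D &, injective f}.
Proof.
elim/(@ltn_ind): {D}_.+1 {-2}D (ltnSn #|D|) r => // n IHn D ltDn r hall.
have [->|[i iD]] := set_0Vmem D.
  by exists id; split=> i; rewrite inE.
case: (pickP (fun S : {set T} => [&& S \proper D, S != set0 & #|nbrs r S| <= #|S|])).
  move=> S /and3P[SD S0 tight].
  have sSD := proper_sub SD.
  have [|f1 [f1r f1inj]] := IHn #|D| ltDn S (proper_card SD) r.
    by move=> S' S'S; apply: hall; exact: subset_trans S'S sSD.
  have ltDS : #|D :\: S| < #|D|.
    by have := cardsID S D; rewrite (setIidPr sSD) -card_gt0 in S0 *; lia.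
  have [|f2 [f2r f2inj]] := IHn #|D| ltDn (D :\: S) ltDS (fun i => r i :\: nbrs r S).
    move=> S' S'D; rewrite nbrsD.
    have dis : S :&: S' = set0.
      apply/setP=> x; rewrite !inE; apply/negP=> /andP[xS xS'].
      by have := subsetP S'D x xS'; rewrite inE xS.
    (* Hall's condition for the union, minus the tight contribution of [S], is the condition
       required of [S']. *)
    have /hall : S :|: S' \subset D.
      by rewrite subUset sSD (subset_trans S'D) // subsetDl.
    rewrite nbrsU; have := cardsUI S S'; rewrite dis cards0.
    have := cardsU (nbrs r S') (nbrs r S); rewrite [_ :|: nbrs r S]setUC.
    by rewrite cardsD; lia.
  exists (fun i => if i \in S then f1 i else f2 i); split.
    move=> j jD; case: ifP => jS; first exact: f1r.
    have : j \in D :\: S by rewrite inE jS.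
    by move/f2r; rewrite inE => /andP[].
  have f12 x y : x \in S -> y \in D -> y \notin S -> f1 x <> f2 y.
    move=> xS yD yS E.
    have : y \in D :\: S by rewrite inE yS.
    move/f2r; rewrite inE -E => /andP[/negP nS _]; apply: nS.
    by apply/bigcupP; exists x => //; exact: f1r.
  move=> x y xD yD; case: ifPn => xS; case: ifPn => yS.
  - exact: f1inj.
  - by move/f12 => /(_ xS yD yS).
  - by move/esym/f12 => /(_ yS xD xS).
  - by apply: f2inj; rewrite inE ?xS ?yS.
move=> loose.
have /card_gt0P[y] : 0 < #|r i|.
  have := hall [set i]; rewrite sub1set iD cards1 => /(_ isT).
  by rewrite /nbrs big_set1.
move=> yr.
have ltDi : #|D :\ i| < #|D| by rewrite (cardsD1 i D) iD.
have [|f [fr finj]] := IHn #|D| ltDn (D :\ i) ltDi (fun i => r i :\: [set y]).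
  move=> S SD; rewrite nbrsD.
  have [->|S0] := eqVneq S set0; first by rewrite cards0.
  have prS : S \proper D.
    by apply: sub_proper_trans SD _; rewrite properD1.
  have := loose S; rewrite prS S0 /= => /negbT; rewrite -ltnNge.
  by have := cardsD1 y (nbrs r S); case: (y \in _) => /=; lia.
exists (fun j => if j == i then y else f j); split.
  move=> j jD; case: eqP => [-> //|/eqP ji].
  have /fr : j \in D :\ i by rewrite !inE ji.
  by rewrite inE => /andP[].
have fy x : x \in D -> x != i -> f x != y.
  move=> xD xi; have /fr : x \in D :\ i by rewrite !inE xi.
  by rewrite !inE => /andP[].
move=> x z xD zD; case: eqP => [->|/eqP xi]; case: eqP => [-> //|/eqP zi].
- by move=> E; have := fy z zD zi; rewrite -E eqxx.
- by move=> E; have := fy x xD xi; rewrite E eqxx.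
- by apply: finj; rewrite !inE ?xi ?zi.
Qed.

End Hall.

(* Koenig's edge colouring of the [k]-regular bipartite multigraph whose edges
   are the elements of [E], [x] joining [p x] to [q x]. *)
Lemma regular_edge_colouring (T J : finType) (p q : T -> J) k (E : {set T}) :
  (forall j, #|[set x in E | p x == j]| = k) ->
  (forall j, #|[set x in E | q x == j]| = k) ->
  exists c : T -> nat, [/\ {in E, forall x, c x < k},
    {in E &, forall x y, c x = c y -> p x = p y -> x = y} &
    {in E &, forall x y, c x = c y -> q x = q y -> x = y}].
Proof.
elim: k E => [|k IHk] E pk qk.
  have E0 x : x \in E -> False.
    move=> xE; have /eqP := pk (p x); rewrite cards_eq0 => /eqP/setP/(_ x).
    by rewrite !inE xE eqxx.
  by exists (fun=> 0); split=> [x /E0|x y /E0|x y /E0].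
have cardfib (h : T -> J) (S : {set J}) :
    (forall j, #|[set x in E | h x == j]| = k.+1) ->
    #|[set x in E | h x \in S]| = #|S| * k.+1.
  move=> hk; rewrite -sum1_card (partition_big h (mem S)) /=; last first.
    by move=> x; rewrite inE => /andP[].
  rewrite -sum_nat_const; apply: eq_bigr => j jS; rewrite -(hk j) -sum1_card.
  apply: eq_bigl => x; rewrite !inE; case: eqP => [->|_]; last by rewrite !andbF.
  by rewrite (jS : j \in S) !andbT.
pose r j := [set q x | x in [set x in E | p x == j]].
(* Double counting: the [#|S| * k.+1] edges leaving [S] all end among its neighbours, each of which
   receives [k.+1] edges. *)
have [|f [fr finj]] := @hall_marriage J r setT.
  move=> S _; rewrite -(leq_pmul2r (ltn0Sn k)) -(cardfib p) // -(cardfib q) //.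
  apply: subset_leq_card; apply/subsetP=> x; rewrite !inE => /andP[xE pS].
  rewrite xE /=; apply/bigcupP; exists (p x) => //.
  by apply: imset_f; rewrite inE xE eqxx.
have /fin_all_exists [m mP] : forall j, exists x, [/\ x \in E, p x = j & q x = f j].
  move=> j; have /imsetP[x] := fr j (in_setT j).
  by rewrite inE => /andP[xE /eqP px] ->; exists x.
have mp j : p (m j) = j by case: (mP j).
have mq j : q (m j) = f j by case: (mP j).
have injf : injective f by move=> x y; apply: finj.
(* [M] becomes the last colour class. It uses exactly one edge at every vertex of either side, so
   its removal leaves a [k]-regular graph. *)
pose M := [set m j | j in J].
have ME x : x \in M -> x = m (p x) by case/imsetP=> j _ ->; rewrite mp.
have mM j : m j \in M by apply: imset_f.
have fibD (h : T -> J) : (forall j, exists i, [/\ m i \in E, h (m i) = j &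
      forall x, x \in M -> h x = j -> x = m i]) ->
    (forall j, #|[set x in E | h x == j]| = k.+1) ->
    forall j, #|[set x in E :\: M | h x == j]| = k.
  move=> hM hk j; have [i [iE hi uni]] := hM j.
  have := hk j; rewrite (cardsD1 (m i)) !inE iE hi eqxx /= add1n => -[<-].
  apply: eq_card => x; rewrite !inE; case: (x \in E); rewrite ?andbF //= ?andbT.
  case: eqP => [hx|_]; rewrite ?andbF ?andbT //; congr (~~ _).
  apply/idP/eqP => [xM|->]; last exact: mM.
  exact: uni.
have [||c [ck cp cq]] := IHk (E :\: M).
- apply: fibD pk => j; exists j; split=> //; first by case: (mP j).
  by move=> x xM pj; rewrite (ME x xM) pj.
- apply: fibD qk => j; have /codomP[i ->] : j \in codom f.
    by rewrite (inj_card_onto injf).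
  exists i; split=> //; first by case: (mP i).
  by move=> x /ME ->; rewrite mq => /injf ->.
exists (fun x => if x \in M then k else c x).
have inD x : x \in E -> x \notin M -> x \in E :\: M by rewrite inE => -> ->.
have Mc x : x \in E -> x \notin M -> c x < k by move=> xE xM; apply/ck/inD.
split.
- move=> x xE; case: ifPn => // xM; exact: leqW (Mc x xE xM).
- move=> x y xE yE; case: ifPn => xM; case: ifPn => yM.
  + by move=> _ pxy; rewrite (ME x xM) (ME y yM) pxy.
  + by have := Mc y yE yM; lia.
  + by have := Mc x xE xM; lia.
  + by apply: cp; exact: inD.
- move=> x y xE yE; case: ifPn => xM; case: ifPn => yM.
  + by move=> _; rewrite (ME x xM) (ME y yM) !mq => /injf ->.
  + by have := Mc y yE yM; lia.
  + by have := Mc x xE xM; lia.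
  + by apply: cq; exact: inD.
Qed.

(** * Odd-even transposition sort *)

Section OddEvenSort.
Variable n : nat.
Implicit Types (a : nat -> nat) (t x k : nat).

(* Round [t] compares the positions [x, x+1] with [x] of the parity of [t]. *)
Definition oe_round t a x : nat :=
  if odd x == odd t then (if x.+1 < n then minn (a x) (a x.+1) else a x)
  else (if 0 < x then maxn (a x.-1) (a x) else a x).

Fixpoint oe_sort t a : nat -> nat :=
  if t is t'.+1 then oe_round t' (oe_sort t' a) else a.

(** As in the 0-1 principle, entries are only compared with a threshold [k]; progress is measured by
    the number of large entries to the right of a cut. *)
Definition tail_count k a x := \sum_(x <= j < n) (k <= a j).

Lemma tail_countS k a x : x < n -> tail_count k a x = (k <= a x) + tail_count k a x.+1.
Proof. by move=> ltxn; rewrite /tail_count big_ltn. Qed.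

Lemma tail_count_geq k a x : n <= x -> tail_count k a x = 0.
Proof. by move=> ?; rewrite /tail_count big_geq. Qed.

Lemma tail_count_le k a x : tail_count k a x <= n - x.
Proof.
rewrite -[n - x]muln1 -sum_nat_const_nat; apply: leq_sum => j _; exact: leq_b1.
Qed.

(** The round compares [x] with [x.+1], [x.+2] with [x.+3] and so on, so no comparison crosses the
    cut before [x]. *)
Lemma tail_count_round_even k t a x :
  odd x = odd t -> tail_count k (oe_round t a) x = tail_count k a x.
Proof.
elim/ltn_ind: {x}(n - x) {-2}x (erefl (n - x)) => d IHd x dE oddx.
have [lenx|ltxn] := leqP n x; first by rewrite !tail_count_geq.
have [lenx1|ltx1n] := leqP n x.+1.
  rewrite !(@tail_countS _ _ x) // !(tail_count_geq _ _ lenx1) /oe_round oddx eqxx.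
  by rewrite ltnNge lenx1.
rewrite !(@tail_countS _ _ x) // !(@tail_countS _ _ x.+1) //.
rewrite (IHd (n - x.+2)) //=; [|lia|by rewrite negbK].
rewrite /oe_round oddx eqxx /= ltx1n oddx.
have -> : (~~ odd t == odd t) = false by case: (odd t).
by rewrite !addnA; congr (_ + _); case: (leqP (a x)) => _ //; rewrite addnC.
Qed.

(** Only the comparison of [x.-1] with [x] crosses the cut, and it leaves the maximum at [x]. *)
Lemma tail_count_round_odd k t a x : x < n -> 0 < x -> odd x != odd t ->
  tail_count k (oe_round t a) x = (k <= maxn (a x.-1) (a x)) + tail_count k a x.+1.
Proof.
move=> ltxn x0 oddx; rewrite tail_countS // tail_count_round_even /=.
  by rewrite /oe_round (negPf oddx) x0.
by move: oddx; case: (odd x); case: (odd t).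
Qed.

Lemma tail_count_round0 k t a : tail_count k (oe_round t a) 0 = tail_count k a 0.
Proof.
case: (boolP (odd t)) => ot; last by apply: tail_count_round_even; case: odd ot.
case: (posnP n) => [n0|n0]; first by rewrite !tail_count_geq ?n0.
by rewrite !(@tail_countS _ _ 0) // tail_count_round_even /oe_round /= ot.
Qed.

Lemma leq_tail_count_round k t a x :
  tail_count k a x <= tail_count k (oe_round t a) x.
Proof.
case: (posnP x) => [->|x0]; first by rewrite tail_count_round0.
have [lenx|ltxn] := leqP n x; first by rewrite !tail_count_geq.
have [oddx|oddx] := eqVneq (odd x) (odd t); first by rewrite tail_count_round_even.
rewrite tail_count_round_odd // tail_countS // leq_add2r leq_max.
by case: (k <= a x); rewrite ?orbT.
Qed.

(* The [r]-th largest of the entries that are at least [k] is delayed by at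
   most [2 (r - 1)] rounds, and then moves right in every round. *)
Lemma oe_sort_tail_count k a t r x : r <= tail_count k a 0 ->
  x + r <= n -> x + r.*2 <= t.+2 -> r <= tail_count k (oe_sort t a) x.
Proof.
elim: t r x => [|t IHt] r x rm xrn xrt.
  by case: x xrn xrt => [//|x]; case: r rm => //= r _; rewrite doubleS; lia.
case: (posnP r) => [-> //|r0].
have m0 : r <= tail_count k (oe_sort t.+1 a) 0.
  by elim: (t.+1) => //= s IHs; rewrite tail_count_round0.
case: (posnP x) => [-> //|x0] /=.
have [le|gt] := leqP (x + r.*2) t.+2.
  by apply: leq_trans (leq_tail_count_round _ _ _ _); apply: IHt.
(* Equality forces the parity for which this round compares [x.-1] with [x]. If one of the two
   entries is large, a large one lands at [x] and joins the [r.-1] beyond it; if neither is, all [r]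
   already lie beyond [x]. *)
have xE : x + r.*2 = t.+3 by lia.
have ltxn : x < n by lia.
rewrite tail_count_round_odd //; last first.
  by have := congr1 odd xE; rewrite oddD odd_double /=; case: odd; case: odd.
have : r <= tail_count k (oe_sort t a) x.-1 by apply: IHt; lia.
have : r.-1 <= tail_count k (oe_sort t a) x.+1 by apply: IHt; lia.
rewrite (@tail_countS _ _ x.-1); last lia.
rewrite prednK // (@tail_countS _ _ x) // leq_max.
by case: (k <= _ x.-1); case: (k <= _ x) => /=; lia.
Qed.

(** For [r = n - k] and [x = k], the large entries fill the whole tail from [k] on. For permutations
    this lower bound is enough, by [nondecreasing_row_id]. *)
Lemma oe_sort_sorted a k : k < n -> n - k <= tail_count k a 0 ->
  k <= oe_sort n.*2 a k.
Proof.
move=> ltkn cnt.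
have := @oe_sort_tail_count k a n.*2 (n - k) k cnt.
rewrite tail_countS //; have := tail_count_le k (oe_sort n.*2 a) k.+1.
by case: (k <= _) => //=; lia.
Qed.

End OddEvenSort.

(** * Realising a matching of horizontal edges *)

Definition near (a b : nat) : bool := (a.+1 == b) || (b.+1 == a).

Definition path2 n (c : bool -> 'I_n) : bool := near (c false) (c true).

Definition path3 n (c : option bool -> 'I_n) : bool :=
  [&& near (c (Some false)) (c None), near (c None) (c (Some true)) &
      c (Some false) != c (Some true)].

Lemma path2_inj n (c : bool -> 'I_n) : path2 c -> injective c.
Proof. by rewrite /path2 /near => cP [] [] // /(congr1 val) /=; lia. Qed.

Lemma path3_inj n (c : option bool -> 'I_n) : path3 c -> injective c.
Proof.
case/and3P; rewrite /near -val_eqE /= => c1 c2 c3.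
by move=> [[]|] [[]|] // /(congr1 val) /=; lia.
Qed.

Lemma path2_adj n (c : bool -> 'I_n) p p' : path2 c -> p != p' -> near (c p) (c p').
Proof. by rewrite /path2 /near; case: p p' => [] [] //; rewrite orbC. Qed.

Lemma path3_adj n (c : option bool -> 'I_n) q q' :
  path3 c -> (q == None) != (q' == None) -> near (c q) (c q').
Proof.
by case/and3P; rewrite /near; case: q q' => [[]|] [[]|] //= ? ? _ _; rewrite // orbC.
Qed.

Lemma grid_adjE m n (u v : grid_vertex m n) :
  grid_adj u v = ((u.1 == v.1) && near u.2 v.2) || ((u.2 == v.2) && near u.1 v.1).
Proof. by []. Qed.

Definition block_embedding m n (f : block -> grid_vertex m n) : Prop :=
  injective f /\ (forall x y, block_adj x y -> grid_adj (f x) (f y)).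

Lemma wide_block_embedding m n (r : bool -> 'I_m) (c : option bool -> 'I_n) :
  path2 r -> path3 c -> block_embedding (fun x => (r x.1, c x.2)).
Proof.
move=> rP cP; split; first by move=> [p q] [p' q'] [/(path2_inj rP) -> /(path3_inj cP) ->].
move=> [p q] [p' q']; rewrite grid_adjE => /orP[] /andP[/= h1 h2].
  by rewrite (eqP h1) eqxx (path3_adj cP h2).
by rewrite (eqP h2) eqxx (path2_adj rP h1) orbT.
Qed.

Lemma tall_block_embedding m n (r : option bool -> 'I_m) (c : bool -> 'I_n) :
  path3 r -> path2 c -> block_embedding (fun x => (r x.2, c x.1)).
Proof.
move=> rP cP; split; first by move=> [p q] [p' q'] [/(path3_inj rP) -> /(path2_inj cP) ->].
move=> [p q] [p' q']; rewrite grid_adjE => /orP[] /andP[/= h1 h2].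
  by rewrite (eqP h1) eqxx (path3_adj rP h2) orbT.
by rewrite (eqP h2) eqxx (path2_adj cP h1).
Qed.

(** The block around an edge stays within 2 of the left end in each coordinate, so overlapping
    blocks have left ends at most 4 apart; hence the modulus 5 in [colour]. *)
Definition close (a b : nat) : bool := (a <= b + 2) && (b <= a + 2).

Lemma edge_block m n (v w : grid_vertex m n) :
  1 < m -> 1 < n -> (2 < m) || (2 < n) -> w.1 = v.1 -> val w.2 = (val v.2).+1 ->
  exists (f : block -> grid_vertex m n) (x y : block),
    [/\ block_embedding f, forall b, close (f b).1 v.1 && close (f b).2 v.2,
        f x = v, f y = w & reach block_adj 5 (swap x y)].
Proof.
case: v w => [i j] [_ j'] m1 n1 mn /= -> j'E.
have [i' ii'] : exists i' : 'I_m, near i i'.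
  have [lt|ge] := ltnP i.+1 m; first by exists (Ordinal lt); rewrite /near eqxx.
  have lt : i.-1 < m by have := ltn_ord i; lia.
  by exists (Ordinal lt); rewrite /near /=; lia.
have [n2|n2] := ltnP 2 n.
  have swab : reach block_adj 5 (swap ba bb) by apply: reach_leq reach_swap_ab.
  pose r (b : bool) := if b then i' else i.
  have rP : path2 r by [].
  have rcl b : close (r b) i by rewrite /close; case: b => /=; move: ii'; rewrite /near; lia.
  have [lt|ge] := ltnP j'.+1 n.
    pose c q := match q with Some false => j | None => j' | Some true => Ordinal lt end.
    have cP : path3 c.
      by rewrite /path3 /near -val_eqE /= j'E !eqxx /=; lia.
    exists (fun x => (r x.1, c x.2)), ba, bb; split=> //; first exact: wide_block_embedding.
    by move=> [p q] /=; rewrite rcl /close; case: q => [[]|] /=; lia.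
  (* At the right border the block extends to the left and is read in mirror image. *)
  have lt : j.-1 < n by have := ltn_ord j; lia.
  pose c q := match q with Some false => j' | None => j | Some true => Ordinal lt end.
  have cP : path3 c.
    by rewrite /path3 /near -val_eqE /= j'E !eqxx /=; have := ltn_ord j'; lia.
  exists (fun x => (r x.1, c x.2)), bb, ba; split=> //; first exact: wide_block_embedding.
    by move=> [p q] /=; rewrite rcl /close; case: q => [[]|] /=; lia.
  by apply: reach_eq swab => -[[] [[]|]].
have m2 : 2 < m by lia.
pose c (b : bool) := if b then j' else j.
have cP : path2 c by rewrite /path2 /near /= j'E eqxx.
have ccl b : close (c b) j by rewrite /close; case: b => /=; lia.
case: (boolP ((0 < i) && (i.+1 < m))) => [/andP[i0 im]|].
  have lt : i.-1 < m by lia.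
  pose r q := match q with Some false => Ordinal lt | None => i | Some true => Ordinal im end.
  have rP : path3 r by rewrite /path3 /near -val_eqE /=; lia.
  exists (fun x => (r x.2, c x.1)), bb, be; split=> //.
  - exact: tall_block_embedding.
  - by move=> [p q] /=; rewrite ccl /close; case: q => [[]|] /=; lia.
  - exact: reach_swap_be.
move=> iend.
(* In an end row, the tall block takes the next two rows inwards and the edge is its short end. *)
pose k1 := if i == 0 :> nat then 1 else i.-1.
pose k2 := if i == 0 :> nat then 2 else i.-2.
have [lt1 lt2] : k1 < m /\ k2 < m.
  by rewrite /k1 /k2; case: (nat_of_ord i =P 0) => i0; have := ltn_ord i; lia.
pose r q := match q with Some false => i | None => Ordinal lt1 | Some true => Ordinal lt2 end.
have rP : path3 r.
  rewrite /path3 /near -val_eqE /= /k1 /k2; have := ltn_ord i.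
  by case: (nat_of_ord i =P 0) => i0 /=; lia.
exists (fun x => (r x.2, c x.1)), ba, bd; split=> //.
- exact: tall_block_embedding.
- move=> [p q] /=; rewrite ccl /close; case: q => [[]|] /=; rewrite /k1 /k2;
  by case: (nat_of_ord i =P 0) => i0 /=; lia.
- exact: reach_swap_ad.
Qed.

Lemma eq_vertex m n (u v : grid_vertex m n) : u.1 = v.1 -> u.2 = v.2 :> nat -> u = v.
Proof. by case: u v => [i j] [i' j'] /= -> /val_inj ->. Qed.

Section Matching.
Variables (m n : nat) (H : grid_vertex m n -> grid_vertex m n).
Hypotheses (m1 : 1 < m) (n1 : 1 < n) (mn : (2 < m) || (2 < n)).
Hypotheses (HK : involutive H) (Hrow : forall v, (H v).1 = v.1).
Hypothesis Hcol : forall v, (H v).2 <= (v.2).+1.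

Implicit Types u v : grid_vertex m n.

Definition left_end (v : grid_vertex m n) := if (H v).2 < v.2 then H v else v.

(* Distinct left ends of the same colour are at distance at least 5 in some coordinate, so
   that the blocks around their edges are disjoint. *)
Definition colour (v : grid_vertex m n) := (v.1 %% 5) * 5 + v.2 %% 5.

Lemma colour_inj (u v : grid_vertex m n) :
  u.1 < v.1 + 5 -> v.1 < u.1 + 5 -> u.2 < v.2 + 5 -> v.2 < u.2 + 5 ->
  colour u = colour v -> u = v.
Proof.
case: u v => [i j] [i' j']; rewrite /colour /= => h1 h2 h3 h4 E.
by congr (_, _); apply: val_inj => /=; lia.
Qed.

Lemma leq_col_match v : v.2 <= ((H v).2).+1.
Proof. by rewrite -{1}[v]HK; exact: Hcol. Qed.

Lemma left_endH v : left_end (H v) = left_end v.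
Proof.
rewrite /left_end HK; case: (ltngtP (H v).2 v.2) => // E.
by apply: eq_vertex; rewrite ?Hrow.
Qed.

Lemma left_end_cases v : H v = v \/
  ((H (left_end v)).2 == (left_end v).2.+1 :> nat) && ((v == left_end v) || (v == H (left_end v))).
Proof.
rewrite /left_end; have := Hcol v; have := leq_col_match v; case: (ltngtP (H v).2 v.2) => E h1 h2.
- by right; rewrite HK !eqxx orbT andbT; lia.
- by right; rewrite !eqxx andbT; lia.
- by left; apply: eq_vertex; rewrite ?Hrow.
Qed.

(** The colour is read at the left end, so that both endpoints of an edge are exchanged or fixed
    together. *)
Definition restrict (A : pred nat) v := if A (colour (left_end v)) then H v else v.

Definition is_left_end k v := ((H v).2 == v.2.+1 :> nat) && (colour v == k).

Lemma reach_restrict1 (k : nat) : reach (@grid_adj m n) 5 (restrict (pred1 k)).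
Proof.
have [T [pt [pt_inj ptP pt_onto]]] : exists (T : finType) (pt : T -> grid_vertex m n),
    [/\ injective pt, forall t, is_left_end k (pt t) & forall v, is_left_end k v -> exists t, pt t = v].
  exists {v : grid_vertex m n | is_left_end k v}, val; split; [exact: val_inj | exact: valP |].
  by move=> v vP; exists (exist (fun v => is_left_end k v) v vP).
have colT t : colour (pt t) = k by have /andP[_ /eqP] := ptP t.
have left_endT (t : T) : left_end (pt t) = pt t.
  have /andP[/eqP E _] := ptP t; by rewrite /left_end E ltnNge leqnSn.
have /fin_all_exists [f /fin_all_exists [x /fin_all_exists [y P]]] (t : T) :
    exists (f : block -> grid_vertex m n) (x y : block),
    [/\ block_embedding f,
        forall b, close (f b).1 (pt t).1 && close (f b).2 (pt t).2,
        f x = pt t, f y = H (pt t) & reach block_adj 5 (swap x y)].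
  by apply: edge_block => //; have /andP[/eqP] := ptP t.
have sameT (t : T) u : colour u = k ->
    u.1 < (pt t).1 + 5 -> (pt t).1 < u.1 + 5 ->
    u.2 < (pt t).2 + 5 -> (pt t).2 < u.2 + 5 -> u = pt t.
  by move=> uk h1 h2 h3 h4; apply: colour_inj; rewrite ?colT.
have Rl (t : T) : restrict (pred1 k) (pt t) = H (pt t).
  by rewrite /restrict left_endT /= colT eqxx.
have Rr (t : T) : restrict (pred1 k) (H (pt t)) = pt t.
  by rewrite /restrict left_endH left_endT /= colT eqxx HK.
have Rmoved u : restrict (pred1 k) u <> u ->
    exists t : T, left_end u = pt t /\ (u = pt t \/ u = H (pt t)).
  rewrite /restrict /=; case: eqP => // uk; case: (left_end_cases u) => // /andP[E1 E2] _.
  have tP : is_left_end k (left_end u) by rewrite /is_left_end E1 uk eqxx.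
  have [t tE] := pt_onto _ tP; exists t; rewrite tE; split=> //.
  by case/orP: E2 => /eqP; [left | right].
apply: (@reach_extend T _ _ block_adj _ f) (fun t => swap (x t) (y t)) _ _ _ _.
(* Blocks with a common vertex have left ends less than 5 apart and of the same colour, so they are
   the same block. *)
- move=> t t' b b' E; have [[injf _] fcl _ _ _] := P t.
  have [_ fcl' _ _ _] := P t'.
  have tt' : t = t'.
    apply: pt_inj; apply: sameT (colT t) _ _ _ _;
    by have := fcl b; have := fcl' b'; rewrite -E /close; clear; lia.
  by split=> //; apply: injf; rewrite E tt'.
- by move=> t b b'; have [[_ adjf] _ _ _ _] := P t; exact: adjf.
- by move=> t; case: (P t).
- move=> t b; have [[injf _] fcl fx fy _] := P t.
  rewrite /swap; case: eqP => [->|bx]; first by rewrite fx fy Rl.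
  case: eqP => [->|yx]; first by rewrite fx fy Rr.
  (* Any other vertex of the block is fixed: if it moved, the left end of its edge would be within 3
     of [pt t] and of the same colour, hence equal to [pt t]. *)
  apply/eqP/negPn/negP => /eqP /Rmoved [t' [E1 E2]].
  have le1 : (left_end (f t b)).1 = (f t b).1.
    by rewrite /left_end; case: ifP => // _; rewrite Hrow.
  have le2 : (left_end (f t b)).2 <= (f t b).2 <= (left_end (f t b)).2.+1.
    by rewrite /left_end; have := leq_col_match (f t b); case: ifP => // ?; lia.
  have t'E : pt t' = pt t.
    apply: sameT (colT t') _ _ _ _; rewrite -E1 ?le1; have := fcl b; rewrite /close; lia.
  by case: E2; rewrite t'E => E2; [apply: bx | apply: yx]; apply: injf; rewrite E2.
- move=> v vo; apply/eqP/negPn/negP => /eqP /Rmoved [t [_ [vt|vt]]].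
  + by case: (P t) => _ _ fx _ _; case: (vo t (x t)); rewrite fx.
  + by case: (P t) => _ _ _ fy _; case: (vo t (y t)); rewrite fy.
Qed.

Lemma reach_restrict k : reach (@grid_adj m n) (k * 5) (restrict (fun c => c < k)).
Proof.
elim: k => [|k IHk]; first by move=> v; rewrite /restrict ltn0.
rewrite mulSnr.
have := reach_comp IHk (reach_restrict1 k); apply: reach_eq => v /=.
rewrite {2}/restrict /=; case: eqP => [E|/eqP ne].
  by rewrite /restrict left_endH E ltnn ltnSn.
by rewrite /restrict ltnS [in RHS]leq_eqVlt (negPf ne).
Qed.

Lemma reach_matching : reach (@grid_adj m n) 125 H.
Proof.
apply: reach_eq (reach_restrict 25) => v; rewrite /restrict /colour.
by case: ifP => //; lia.
Qed.

End Matching.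

(** * Routing within rows, within columns, and on the whole grid *)

Section RowRouting.
Variables (m n : nat).
Hypotheses (m1 : 1 < m) (n1 : 1 < n) (mn : (2 < m) || (2 < n)).
Notation vertex := (grid_vertex m n).
Implicit Types (rho : vertex -> vertex) (v : vertex).

(** Destination columns as a word over [nat], to which the sort applies. The default 0 is never read
    by a round at a position below [n]. *)
Definition row_word rho (i : 'I_m) (x : nat) : nat :=
  oapp (fun j : 'I_n => val (rho (i, j)).2) 0 (insub x).

Lemma row_wordE rho i (j : 'I_n) : row_word rho i j = (rho (i, j)).2.
Proof. by rewrite /row_word valK. Qed.

Definition to_col v (x : nat) : vertex := (v.1, insubd v.2 x).

Lemma to_col1 v x : (to_col v x).1 = v.1. Proof. by []. Qed.

Lemma to_col2 v x : x < n -> (to_col v x).2 = x :> nat.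
Proof. by move=> ltxn; rewrite /= val_insubd ltxn. Qed.

Lemma to_colK v x : to_col (to_col v x) v.2 = v.
Proof.
by apply: eq_vertex => //; rewrite to_col2.
Qed.

(** Both partners test the same strict inequality, which makes the map an involution. *)
Definition oe_match t rho v : vertex :=
  let a := row_word rho v.1 in let x := nat_of_ord v.2 in
  if odd x == odd t then
    (if (x.+1 < n) && (a x.+1 < a x) then to_col v x.+1 else v)
  else (if (0 < x) && (a x < a x.-1) then to_col v x.-1 else v).

Lemma oe_match_row t rho v : (oe_match t rho v).1 = v.1.
Proof. by rewrite /oe_match; case: ifP => _; case: ifP. Qed.

Lemma oe_match_col t rho v : (oe_match t rho v).2 <= v.2.+1.
Proof.
rewrite /oe_match; case: ifP => _; case: ifP => // /andP[h _].
  by rewrite to_col2.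
rewrite to_col2; first by apply: leqW; exact: leq_pred.
exact: leq_ltn_trans (leq_pred _) (ltn_ord v.2).
Qed.

Lemma oe_matchK t rho : involutive (oe_match t rho).
Proof.
move=> v; rewrite {2}/oe_match; case: ifPn => par; case: ifPn => [/andP[h1 h2]|no].
- rewrite /oe_match to_col1 to_col2 //= h2.
  by rewrite (eqP par) (_ : (~~ odd t == odd t) = false) ?to_colK //; case: odd.
- by rewrite /oe_match par (negPf no).
- have lt : (nat_of_ord v.2).-1 < n by apply: leq_ltn_trans (leq_pred _) (ltn_ord v.2).
  have par' : odd (nat_of_ord v.2).-1 == odd t.
    by move: par h1; case: (nat_of_ord v.2) => //= x; case: (odd x); case: (odd t).
  by rewrite /oe_match to_col1 to_col2 // par' prednK // h2 ltn_ord to_colK.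
- by rewrite /oe_match (negPf par) (negPf no).
Qed.

Lemma row_word_match t rho i x : x < n ->
  row_word (rho \o oe_match t rho) i x = oe_round n t (row_word rho i) x.
Proof.
move=> ltxn; rewrite -[x in LHS]/(val (Ordinal ltxn)) row_wordE /=.
have rowE v : (rho v).2 = row_word rho v.1 v.2 :> nat by case: v => *; rewrite row_wordE.
rewrite rowE oe_match_row /oe_match /oe_round /=.
case: ifP => _; case: ifP => //= h; rewrite ?val_insubd.
- by case/andP: h => -> /ltnW/minn_idPr ->.
- by move: h; case: (x.+1 < n) => //= /negbT; rewrite -leqNgt => /minn_idPl ->.
- case/andP: h => x0 h; rewrite (_ : x.-1 < n) ?x0; last lia.
  by rewrite (maxn_idPl (ltnW h)).
- by move: h; case: (0 < x) => //= /negbT; rewrite -leqNgt => /maxn_idPr ->.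
Qed.

Lemma oe_round_eq t a b : (forall x, x < n -> a x = b x) ->
  forall x, x < n -> oe_round n t a x = oe_round n t b x.
Proof.
move=> ab x ltxn; rewrite /oe_round ab // (ab x.-1); last lia.
by case: ifP => //; case: ifP => // h _; rewrite ab.
Qed.

(** Here [h] is what has been performed and [rho'] what remains. A round inserts its matching twice
    between them, which changes nothing as it is an involution, and gives one factor to each. *)
Lemma oe_route T rho : injective rho -> (forall v, (rho v).1 = v.1) ->
  exists rho' h, [/\ reach (@grid_adj m n) (T * 125) h, rho =1 rho' \o h,
    injective rho', forall v, (rho' v).1 = v.1 &
    forall i x, x < n -> row_word rho' i x = oe_sort n T (row_word rho i) x].
Proof.
move=> injr rowr; elim: T => [|T [rho' [h [rh rE injr' rowr' wr']]]].
  by exists rho, id.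
exists (rho' \o oe_match T rho'), (oe_match T rho' \o h); split.
- rewrite mulSn; apply: reach_comp rh; apply: reach_matching => //.
  + exact: oe_matchK.
  + exact: oe_match_row.
  + exact: oe_match_col.
- by move=> v /=; rewrite oe_matchK rE.
- by apply: inj_comp => //; exact: inv_inj (oe_matchK _ _).
- by move=> v /=; rewrite rowr' oe_match_row.
- move=> i x ltxn; rewrite row_word_match //=.
  by apply: oe_round_eq => // y lty; exact: wr'.
Qed.

Lemma leq_row_count rho k i : k <= n -> injective rho -> (forall v, (rho v).1 = v.1) ->
  n - k <= tail_count n k (row_word rho i) 0.
Proof.
move=> lekn injr rowr.
have injc : injective (fun j : 'I_n => (rho (i, j)).2).
  move=> j j' E; have /injr [] // : rho (i, j) = rho (i, j').
  by apply: eq_vertex; rewrite ?rowr ?E.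
rewrite /tail_count big_mkord; under eq_bigr do rewrite row_wordE.
rewrite -(reindex_inj injc (P := xpredT) (F := fun j : 'I_n => nat_of_bool (k <= j))) /=.
rewrite -(big_mkord xpredT (fun j => nat_of_bool (k <= j))).
rewrite (big_cat_nat (n := k)) //= [X in _ + X](eq_big_nat _ _ (F2 := fun=> 1)).
  by rewrite sum_nat_const_nat muln1 leq_addl.
by move=> j /andP[-> _].
Qed.

(** A bijection preserves the sum of the column indices, so none of the inequalities can be
    strict. *)
Lemma nondecreasing_row_id rho : injective rho -> (forall v, (rho v).1 = v.1) ->
  (forall v, v.2 <= (rho v).2) -> rho =1 id.
Proof.
move=> injr rowr le.
have /leqif_sum : forall v : vertex, true ->
    val v.2 <= val (rho v).2 ?= iff (val v.2 == val (rho v).2).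
  by move=> v _; split=> //; exact: le.
case=> _; rewrite -(reindex_inj injr (P := xpredT) (F := fun v : vertex => val v.2)) /=.
rewrite eqxx => /esym/forallP E v; apply: eq_vertex => //.
by have /eqP := E v.
Qed.

Lemma reach_row rho : injective rho -> (forall v, (rho v).1 = v.1) ->
  reach (@grid_adj m n) (n.*2 * 125) rho.
Proof.
move=> injr rowr.
have [rho' [h [rh rE injr' rowr' wr']]] := oe_route n.*2 injr rowr.
apply: reach_eq rh => v; rewrite rE /= (nondecreasing_row_id injr' rowr') //; move=> -[i j] /=.
rewrite -row_wordE wr' //; apply: oe_sort_sorted => //.
by apply: leq_row_count => //; exact: ltnW.
Qed.

End RowRouting.

Definition transpose m n (v : grid_vertex m n) : grid_vertex n m := (v.2, v.1).

Lemma reach_col m n (rho : grid_vertex m n -> grid_vertex m n) :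
  1 < m -> 1 < n -> (2 < m) || (2 < n) ->
  injective rho -> (forall v, (rho v).2 = v.2) ->
  reach (@grid_adj m n) (m.*2 * 125) rho.
Proof.
move=> m1 n1 mn injr colr.
pose sigma := @transpose m n \o rho \o @transpose n m.
have rs : reach (@grid_adj n m) (m.*2 * 125) sigma.
  apply: reach_row => //; first by rewrite orbC.
  - by move=> [i j] [i' j'] [E1 E2]; have /injr [-> ->] : rho (j, i) = rho (j', i');
      first by case: (rho _) (rho _) E1 E2 => [? ?] [? ?] /= -> ->.
  - by move=> v; rewrite /sigma /= colr.
(* A single copy, indexed by [unit]: the row routing is transported along the isomorphism of
   transposition. *)
apply: (@reach_extend unit _ _ (@grid_adj n m) _ (fun _ => @transpose n m))
  (fun _ => sigma) _ _ _ _ => //.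
- by move=> [] [] [i j] [i' j'] [-> ->].
- by move=> _ [i j] [i' j']; rewrite !grid_adjE /= orbC.
- by move=> _ [i j]; rewrite /sigma /=; case: (rho _).
- by case=> i j /(_ tt (j, i)).
Qed.

(* The rows [c v] through which the vertices are routed come from an edge
   colouring of the multigraph joining the column of [v] to that of [pi v]. *)
Lemma column_row_column m n (pi : grid_vertex m n -> grid_vertex m n) :
  injective pi ->
  exists s1 s2 s3 : grid_vertex m n -> grid_vertex m n,
    [/\ injective s1 /\ (forall v, (s1 v).2 = v.2),
        injective s2 /\ (forall v, (s2 v).1 = v.1),
        injective s3 /\ (forall v, (s3 v).2 = v.2) &
        pi =1 s3 \o s2 \o s1].
Proof.
move=> injpi.
have fib j : #|[set v : grid_vertex m n | v.2 == j]| = m.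
  rewrite -[RHS]card_ord -cardsT.
  rewrite -(card_imset _ (f := fun i : 'I_m => (i, j) : grid_vertex m n)).
    apply: eq_card => -[i j']; rewrite inE /=; apply/eqP/imsetP => [->|[i' _ [_ ->]] //].
    by exists i.
  by move=> i i' [].
have [j|j|c [ck c1 c2]] := @regular_edge_colouring _ _ snd (snd \o pi) m [set: grid_vertex m n].
- by rewrite -[RHS](fib j); apply: eq_card => v; rewrite !inE.
- rewrite -[RHS](fib j) -[RHS](on_card_preimset (f := pi)).
    by apply: eq_card => v; rewrite !inE.
  by exists (invF injpi) => v _; rewrite ?f_invF ?invF_f.
have {}ck v : c v < m by exact: ck.
(* Vertices of one column have distinct colours, so each can go to the row given by its colour. The
   row phase must then bring it to [d v]; [d] is injective because vertices with the same
   destination column also have distinct colours. *)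
pose s1 v : grid_vertex m n := (Ordinal (ck v), v.2).
have inj1 : injective s1 by move=> u v [/c1 E ?]; apply: E; rewrite ?inE.
pose d v : grid_vertex m n := (Ordinal (ck v), (pi v).2).
have injd : injective d by move=> u v [/c2 E ?]; apply: E; rewrite ?inE.
exists s1, (d \o invF inj1), (pi \o invF injd).
have injI (f : grid_vertex m n -> grid_vertex m n) (F : injective f) : injective (invF F).
  by apply: can_inj => v; exact: f_invF.
split; try split=> //.
- by apply: inj_comp => //; exact: injI.
- by move=> v; rewrite -[in RHS](f_invF inj1 v).
- by apply: inj_comp => //; exact: injI.
- by move=> v; rewrite -[in RHS](f_invF injd v).
- by move=> v; rewrite /= !invF_f.
Qed.

Theorem theorem1 :
  exists C : nat,
    forall (ml ms : nat), ms <= ml -> 3 <= ml -> 2 <= ms ->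
    forall XI XG : config ml ms,
      valid_config XI -> valid_config XG ->
      exists (T : nat) (P : nat -> config ml ms),
        T <= C * ml /\ is_solution XI XG T P.
Proof.
(* Two column phases of [250 * ml] moves, a row phase of [250 * ms], and one final stationary
   step. *)
exists 751 => ml ms le_ms ml3 ms2 XI XG injI injG.
have cardE : #|grid_vertex ml ms| = #|robot ml ms| by rewrite card_prod !card_ord.
have [XI' XIK XIK'] : bijective XI by apply: inj_card_bij => //; rewrite cardE.
have injpi : injective (XG \o XI') by apply: inj_comp => //; exact: can_inj XIK'.
have [s1 [s2 [s3 [[i1 h1] [i2 h2] [i3 h3] piE]]]] := column_row_column injpi.
have ml2 : 1 < ml by exact: ltnW.
have big : (2 < ml) || (2 < ms) by rewrite ml3.
have r := reach_comp (reach_comp (reach_col ml2 ms2 big i3 h3) (reach_row ml2 ms2 big i2 h2))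
  (reach_col ml2 ms2 big i1 h1).
have [|P solP] := reach_solution (Y := XG) r injI.
  by move=> x; rewrite -[RHS]piE /= XIK.
by eexists; exists P; split; last exact: solP; lia.
Qed.
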